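(* For $x\in\mathbb{W}_N$, integers $0=n_0<n_1<n_2<\cdots<n_p=N$ and integers $h_1,\dots,h_p$, set $h(j)=h_k$ for every $j\in(n_{k-1},n_k]$. Then $$\mathbf{Pr}\big[G(m,n_1)<h_1,\,G(m,n_2)<h_2,\dots,G(m,n_p)<h_p\,\big|\,\vec{G}(0)=x\big]=\det\big(F(i,j\,|\,x)\big)_{i,j},$$ where $F$ is the $N\times N$ matrix $$F(i,j\,|\,x)=\frac{1}{2\pi\mathrm{i}}\oint_{|z|=R}dz\,\frac{(zb_j)^{h(j)-1}}{(zb_i)^{x_i}}\,\frac{\prod_{k=1}^{j-1}(z-1/b_k)}{\prod_{k=1}^{i}(z-1/b_k)}\,\prod_{k=1}^{m}\frac{1-a_kb_j}{1-a_k/z}.$$ The radius satisfies $R>\max\{1/b_1,\dots,1/b_N\}$.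
   Context: Parameters $a_i,b_j\in[0,1]$ satisfy $0<a_ib_j<1$ for every $i,j\ge1$. The weights $\omega(i,j)$ are independent geometric random variables with $\mathbf{Pr}[\omega(i,j)=k]=(1-a_ib_j)(a_ib_j)^k$, $k=0,1,2,\dots$. The growth function is $$G(m,n)=\max\{G(m-1,n),G(m,n-1)\}+\omega(m,n),$$ with boundary conditions $G(m,0)\equiv0$ and $G(0,n)=x_n$ for $x_1\le x_2\le x_3\le\cdots$. For a given $N$, $\vec{G}(m)=(G(m,1),\dots,G(m,N))$, a Markov chain in $m$ taking values in $\mathbb{W}_N=\{z\in\mathbb{Z}^N:z_1\le z_2\le\cdots\le z_N\}$. $\mathbf{Pr}[\,\cdot\,|\,\vec{G}(0)=x]$ is the law of the process started from $x$. Circular contours are oriented counter-clockwise. In the integral $\mathrm{i}=\sqrt{-1}$, while $i,j$ are matrix indices.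
   Formalization: The formal theorem assumes h_1 ≤ … ≤ h_p and replaces G(m,0)=0 by a constant boundary value g_0 ≤ x_1 (g_0=0 allowed when x_1 ≥ 0); the formula as printed fails for some decreasing h and for some x_1 < 0. *)

(* Defs.v *)
From HB Require Import structures.
From mathcomp Require Import all_boot all_order all_algebra.
From mathcomp Require Import all_classical all_reals all_analysis.
From mathcomp Require Import complex.

Set Implicit Arguments.
Unset Strict Implicit.
Unset Printing Implicit Defensive.

Import Order.TTheory GRing.Theory Num.Theory.
Local Open Scope classical_set_scope.
Local Open Scope ring_scope.

(* Sequences and arrays written with indices starting from 1 in mathematical
   notation ([a], [b], [x], [h], [w]) are functions on [nat] whose values at
   index 0 are never used. *)

Definition mutually_independent d d' (T : measurableType d)
    (T' : measurableType d') (R : realType) (P : probability T R)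
    (I : eqType) (D : pred I) (X : I -> {RV P >-> T'}) : Prop :=
  forall s : seq I, uniq s -> all D s ->
  forall A : I -> set T', (forall i, measurable (A i)) ->
    P (\bigcap_(i in [set` s]) (X i @^-1` A i)) =
    (\prod_(i <- s) P (X i @^-1` A i))%E.

Definition geometric_weights d (T : measurableType d) (R : realType)
    (P : probability T R) (a b : nat -> R)
    (w : nat -> nat -> {RV P >-> nat}) : Prop :=
  mutually_independent (fun ij : nat * nat => (0 < ij.1)%N && (0 < ij.2)%N)
    (fun ij => w ij.1 ij.2) /\
  (forall i j k : nat, (0 < i)%N -> (0 < j)%N ->
     P (w i j @^-1` [set k]) = ((1 - a i * b j) * (a i * b j) ^+ k)%:E).

(* Growth function with initial condition G(0,n) = x n and constant boundary
   value G(m,0) = g0.  The standard boundary condition is g0 = 0; whenever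
   g0 <= x 1 the boundary value plays no role for m, n >= 1, and
   (G(m,1), ..., G(m,N))_m is the Markov chain on nondecreasing integer
   vectors started from (x 1, ..., x N).  The corner value G(0,0) is never
   used. *)
Fixpoint growth (g0 : int) (x : nat -> int) (w : nat -> nat -> nat)
    (m n : nat) {struct m} : int :=
  match m with
  | 0 => x n
  | m'.+1 =>
    (fix row (n : nat) : int :=
       match n with
       | 0 => g0
       | n'.+1 => Num.max (growth g0 x w m' n'.+1) (row n') + (w m n'.+1)%:Z
       end) n
  end.

Lemma growth0n g0 x w n : growth g0 x w 0 n = x n.
Proof. by []. Qed.

Lemma growthSn0 g0 x w m : growth g0 x w m.+1 0 = g0.
Proof. by []. Qed.

Lemma growthSS g0 x w m n :
  growth g0 x w m.+1 n.+1 =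
  Num.max (growth g0 x w m n.+1) (growth g0 x w m.+1 n) + (w m.+1 n.+1)%:Z.
Proof. by []. Qed.

(* The set W_N, for the vector (x 1, ..., x N) *)
Definition in_W (N : nat) (x : nat -> int) : Prop :=
  forall j : nat, (0 < j)%N -> (j < N)%N -> x j <= x j.+1.

Definition circle (R : realType) (r t : R) : R[i] :=
  (r * cos t +i* (r * sin t))%C.

(* The integral of f over |z| = r, oriented counter-clockwise, for the
   parametrization z = r e^{it}, 0 <= t <= 2 pi, dz = i z dt *)
Definition circle_integral (R : realType) (r : R) (f : R[i] -> R[i]) : R[i] :=
  let g (t : R) : R[i] := f (circle r t) * ('i%C * circle r t) in
  ((\int[lebesgue_measure]_(t in `[0%R, (2 * pi)%R]) complex.Re (g t))
   +i* (\int[lebesgue_measure]_(t in `[0%R, (2 * pi)%R]) complex.Im (g t)))%C.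

Definition F_entry (R : realType) (a b : nat -> R) (x h : nat -> int)
    (m : nat) (r : R) (i j : nat) : R[i] :=
  ((2 * pi)%:C%C * 'i%C)^-1 *
  circle_integral r (fun z =>
    (z * (b j)%:C%C) ^ (h j - 1) / (z * (b i)%:C%C) ^ (x i) *
    (\prod_(1 <= k < j) (z - ((b k)^-1)%:C%C) /
     \prod_(1 <= k < i.+1) (z - ((b k)^-1)%:C%C)) *
    \prod_(1 <= k < m.+1)
      ((1 - (a k * b j)%:C%C) / (1 - (a k)%:C%C / z))).

(* Main.v *)
Require Import Defs.
From mathcomp Require Import all_boot all_order all_algebra.
From mathcomp Require Import all_classical all_reals all_analysis.
From mathcomp Require Import perm complex zify ring lra.
Import Order.TTheory GRing.Theory Num.Theory.
Local Open Scope classical_set_scope.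
Local Open Scope ring_scope.
Import numFieldNormedType.Exports.

(** Rows of the growth function are nondecreasing, so bounding G(m, n_k) by h_k
    for every k amounts to bounding G(m, j) by H(j) for every j <= N, where H is
    the nondecreasing function equal to h_k on the k-th block. The formula is
    proved by revealing the weights one site at a time, row after row.

    Suppose that the sites up to (M+1, j) have been revealed, and consider the
    event that G(M+1, i) < H(i) for i <= j and G(M, i) < H(i) for i > j
    ([stair_event]). When the next site (M+1, j+1) receives the weight k, the
    recursion G = max + k and the monotonicity in i show that the event for j+1
    and H is the event for j and the thresholds in which H(i) is replaced by
    min(H(i), H(j+1) - k) for i <= j+1 ([growth_stair_iff]). Hence the
    probability for j+1 is the geometric average over k of the probabilities for
    j with lowered thresholds.

    The determinant in which the columns i <= j use M+1 factors and the others
    use M factors ([stair_det]) obeys the same recursion ([stair_det_sum]). Write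
    U(M, j, h) for the j-th column and alpha = a_(M+1) b_j. The integrand gives
      U(M+1, j, h) = (1 - alpha) U(M, j, h) + alpha U(M+1, j, h - 1),
      U(M, j, h + 1) = U(M, j, h) + constant * U(M, j+1, h).
    The first relation splits a determinant in two. The second one shows that
    lowering all the thresholds to the left of a column which already has the
    lower threshold only adds to each column a multiple of the next one, which
    leaves the determinant unchanged. Iterating gives the geometric average,
    with a finite sum because a column vanishes when its threshold is low.

    For m = 0 the matrix is unitriangular when x_j < H(j) for all j, and has a
    zero block that is too large for a nonzero determinant otherwise
    ([det_entry0]).

    Independence enters through cylinder events on the sites not yet revealed:
    the induction shows that the probability of the stair event intersected with
    such a cylinder is the determinant times the probability of the cylinder
    ([stair_factorizes]), and only the product rule for cylinders is needed.

    The contour integrals reduce to four facts on rational functions with poles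
    inside the circle: linearity, the integrals of the powers of z, the vanishing
    when the degree at infinity is at most -2 ([contour_laurent_eq0]) and the
    residue of z^n / (z - q). *)

(** * Determinants with two neighbouring column relations *)

(** The two matrices differ by a lower unitriangular factor on the right. *)
Lemma det_add_next_column (C : comNzRingType) (N : nat) (A B : 'M[C]_N)
    (g : 'I_N -> C) :
  (forall i k : 'I_N,
     A i k = B i k + \sum_(l < N | l == k.+1 :> nat) B i l * g k) ->
  \det A = \det B.
Proof.
move=> AB.
pose E : 'M[C]_N := \matrix_(l, k) ((l == k)%:R + (l == k.+1 :> nat)%:R * g k).
have -> : A = B *m E.
  apply/matrixP => i k; rewrite AB !mxE.
  under [RHS]eq_bigr => l _ do rewrite mxE mulrDr.
  rewrite big_split /= [X in _ = X + _](bigD1 k) //= eqxx mulr1.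
  rewrite [X in _ = _ + X + _]big1 ?addr0; last first.
    by move=> l /negPf ->; rewrite mulr0.
  congr (_ + _); rewrite big_mkcond /=; apply: eq_bigr => l _.
  by case: eqP; rewrite ?mul1r ?mul0r ?mulr0.
rewrite det_mulmx; suff -> : \det E = 1 by rewrite mulr1.
rewrite det_trig ?big1 // => [k _|].
  by rewrite mxE eqxx ltn_eqF // mul0r addr0.
apply/is_trig_mxP => l k lk; rewrite mxE.
by rewrite -val_eqE /= !ltn_eqF ?mul0r ?addr0 // ltnW.
Qed.

Lemma det_multilinear_column (C : comNzRingType) (N : nat) (A B D : 'M[C]_N)
    (k0 : 'I_N) (s t : C) :
  (forall i, A i k0 = s * B i k0 + t * D i k0) ->
  (forall i k, k != k0 -> B i k = A i k) ->
  (forall i k, k != k0 -> D i k = A i k) ->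
  \det A = s * \det B + t * \det D.
Proof.
move=> Ak0 BA DA; rewrite -(det_tr A) -(det_tr B) -(det_tr D).
apply: (determinant_multilinear (i0 := k0)).
- by apply/rowP => i; rewrite !mxE Ak0.
- by apply/matrixP => k i; rewrite !mxE BA // eq_sym neq_lift.
- by apply/matrixP => k i; rewrite !mxE DA // eq_sym neq_lift.
Qed.

(** No permutation avoids the zero block: it would map the indices [i >= j]
    injectively into the fewer indices [i > j]. *)
Lemma det_zero_block (C : comNzRingType) (N : nat) (A : 'M[C]_N) (j : 'I_N) :
  (forall i k : 'I_N, (k <= j <= i)%N -> A i k = 0) -> \det A = 0.
Proof.
move=> A0; rewrite /determinant big1 // => s _.
have [i /andP[ji sij]] : exists i : 'I_N, (j <= i)%N && (s i <= j)%N.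
  apply/existsP; apply: contraT => /existsPn /= noi.
  suff : (#|[set i : 'I_N | (j <= i)%N]%SET| <= #|[set i : 'I_N | (j < i)%N]%SET|)%N.
    rewrite leqNgt proper_card //; apply/properP; split.
      by apply/fintype.subsetP => i; rewrite !inE; exact: ltnW.
    by exists j; rewrite !inE ?leqnn ?ltnn.
  rewrite -(card_imset _ (@perm_inj _ s)); apply/subset_leq_card.
  apply/fintype.subsetP => _ /imsetP[i + ->]; rewrite !inE => ji.
  by move: (noi i); rewrite ji /= -ltnNge.
by rewrite (bigD1 i) //= A0 ?ji ?sij // mul0r mulr0.
Qed.

(** Index of the row reached in column [i] once the sites up to (M+1, j) have been
    revealed. *)
Definition stair (M j i : nat) : nat := if (i <= j)%N then M.+1 else M.

Definition lower (j : nat) (c : int) (H : nat -> int) (i : nat) : int :=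
  if (i <= j)%N then Num.min (H i) c else H i.

Lemma stair_le M j i : (i <= j)%N -> stair M j i = M.+1.
Proof. by rewrite /stair => ->. Qed.

Lemma stair_gt M j i : (j < i)%N -> stair M j i = M.
Proof. by rewrite /stair ltnNge => /negPf ->. Qed.

Lemma lower_le j c H i : (i <= j)%N -> lower j c H i = Num.min (H i) c.
Proof. by rewrite /lower => ->. Qed.

Lemma lower_gt j c H i : (j < i)%N -> lower j c H i = H i.
Proof. by rewrite /lower ltnNge => /negPf ->. Qed.

Lemma lower_at j c H : lower j c H j = Num.min (H j) c.
Proof. by rewrite /lower leqnn. Qed.

Lemma lower_lower j (c c' : int) H : c' <= c -> lower j c' (lower j c H) = lower j c' H.
Proof.
move=> cc; apply/funext => i; rewrite /lower; case: (i <= j)%N => //; lia.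
Qed.

Lemma lower_in_W N j c H : in_W N H -> in_W N (lower j c H).
Proof.
move=> HW i i0 iN; have := HW i i0 iN; rewrite /lower.
by case: (leqP i j); case: (leqP i.+1 j) => ? ?; lia.
Qed.

Lemma in_W_le N H i j : in_W N H -> (0 < i)%N -> (i <= j)%N -> (j <= N)%N ->
  H i <= H j.
Proof.
move=> HW i0; elim: j => [|j IH]; first by case: i i0.
rewrite leq_eqVlt => /orP[/eqP -> //|ij jN].
by apply: le_trans (IH _ _) (HW j _ _) => //; lia.
Qed.

Section StairDeterminant.
Variables (C : comNzRingType) (N : nat).
Variables (U : nat -> nat -> nat -> int -> C).
Variables (al : nat -> nat -> C) (ga : nat -> nat -> int -> C).
Hypothesis U_step : forall M i j (h : int), (0 < i <= N)%N -> (0 < j <= N)%N ->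
  U M.+1 i j h = (1 - al M.+1 j) * U M i j h + al M.+1 j * U M.+1 i j (h - 1).
Hypothesis U_next : forall M i j (h : int), (0 < i <= N)%N -> (0 < j < N)%N ->
  U M i j (h + 1) = U M i j h + U M i j.+1 h * ga M j h.

Definition stair_det (M j : nat) (H : nat -> int) : C :=
  \det (\matrix_(i < N, k < N) U (stair M j k.+1) i.+1 k.+1 (H k.+1)).

Lemma stair_det_full M H : stair_det M N H = stair_det M.+1 0 H.
Proof. by congr (\det _); apply/matrixP => i k; rewrite !mxE /stair ltn_ord. Qed.

(** The first column relation splits the determinant in two. In the second
    part, column [j.+1] has threshold [c = H j.+1 - 1] while its left neighbours
    have thresholds at most [c + 1]; the columns with threshold [c + 1] form a
    contiguous range ending at column [j], and by the second relation each of
    them is the column with threshold [c] plus a multiple of the next one. *)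
Lemma stair_det_step M j H : (j < N)%N -> in_W N H ->
  stair_det M j.+1 H = (1 - al M.+1 j.+1) * stair_det M j H
    + al M.+1 j.+1 * stair_det M j.+1 (lower j.+1 (H j.+1 - 1) H).
Proof.
move=> jN HW; pose j0 := Ordinal jN; pose c := H j.+1 - 1.
(* Only the threshold of column j+1 is lowered in H'. *)
pose H' i := if i == j.+1 then c else H i.
have -> : stair_det M j.+1 (lower j.+1 c H) = stair_det M j.+1 H'.
  pose g (k : 'I_N) :=
    if (k < j)%N && (H k.+1 == c + 1) then ga M.+1 k.+1 c else 0.
  symmetry; apply: (@det_add_next_column _ _ _ _ g) => i k; rewrite !mxE.
  rewrite /H' eqSS; case: (ltngtP k j) => [kj|jk|kj].
  - have Hk : H k.+1 <= c + 1.
      by have := @in_W_le N H k.+1 j.+1 HW isT; rewrite /c; lia.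
    have k1N : (k.+1 < N)%N by lia.
    rewrite (big_pred1 (Ordinal k1N)); last by [].
    rewrite !mxE /= /g kj /= /stair /lower !ltnS kj (ltnW kj).
    have [Hkc|Hkc] := eqVneq (H k.+1) (c + 1); last first.
      by rewrite mulr0 addr0; congr U; lia.
    have -> : Num.min (H k.+1) c = c by lia.
    have -> : Num.min (H k.+2) c = c.
      by have := HW k.+1 isT k1N; lia.
    by rewrite Hkc U_next //; have := ltn_ord i; lia.
  - rewrite /g ltnNge (ltnW jk) /= big1 ?addr0 => [|l _]; last by rewrite mulr0.
    by rewrite /lower ltnS leqNgt jk.
  - rewrite /g kj ltnn /= big1 ?addr0 => [|l _]; last by rewrite mulr0.
    by rewrite lower_at; congr U; rewrite /c; lia.
apply: (@det_multilinear_column _ _ _ _ _ j0) => [i|i k kj|i k kj]; rewrite !mxE.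
- rewrite /stair /= leqnn ltnn /H' eqxx.
  by apply: U_step; [have := ltn_ord i; lia|lia].
- have {}kj : k != j :> nat by [].
  by congr U; rewrite /stair; case: (leqP k.+1 j); case: (leqP k.+1 j.+1); lia.
- have {}kj : k != j :> nat by [].
  by rewrite /H' eqSS (negPf kj).
Qed.

(** Iterating [stair_det_step] [K] times leaves a remainder whose column [j.+1]
    is zero. *)
Lemma stair_det_sum M j H K : (j < N)%N -> in_W N H ->
  (forall (h : int) i, (0 < i <= N)%N -> h <= H j.+1 - K%:Z -> U M.+1 i j.+1 h = 0) ->
  stair_det M j.+1 H = \sum_(k < K) (1 - al M.+1 j.+1) * al M.+1 j.+1 ^+ k *
    stair_det M j (lower j.+1 (H j.+1 - k%:Z) H).
Proof.
move=> jN HW U0; set A := al M.+1 j.+1.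
have step n : stair_det M j.+1 H = \sum_(k < n) (1 - A) * A ^+ k *
    stair_det M j (lower j.+1 (H j.+1 - k%:Z) H)
    + A ^+ n * stair_det M j.+1 (lower j.+1 (H j.+1 - n%:Z) H).
  elim: n => [|n IH].
    rewrite big_ord0 add0r expr0 mul1r; congr (\det _); apply/matrixP => i k.
    rewrite !mxE; congr U; rewrite /lower; case: ifP => // kj.
    by have := @in_W_le N H k.+1 j.+1 HW isT kj jN; lia.
  rewrite {1}IH big_ord_recr /= -addrA; congr (_ + _).
  rewrite (stair_det_step _ _ _ jN (lower_in_W _ _ _ _ HW)) lower_at.
  rewrite lower_lower; last lia.
  have -> : Num.min (H j.+1) (H j.+1 - n%:Z) - 1 = H j.+1 - n.+1%:Z by lia.
  by rewrite mulrDr exprSr !mulrA; congr (_ * _ + _); rewrite mulrC.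
rewrite (step K) [X in _ + _ * X](_ : _ = 0) ?mulr0 ?addr0 //.
rewrite /stair_det (expand_det_col _ (Ordinal jN)) big1 // => i _.
rewrite !mxE /= /stair leqnn lower_at U0 ?mul0r //; first by have := ltn_ord i; lia.
by lia.
Qed.

End StairDeterminant.

(** * Integrals of complex-valued curves over a period *)

(** Continuity is expressed through real and imaginary parts because the contour
    integral is the pair of their real integrals. *)
Definition continuous_curve {R : realType} (g : R -> R[i]) : Prop :=
  continuous (fun t => complex.Re (g t)) /\
  continuous (fun t => complex.Im (g t)).

Section Curves.
Variable R : realType.
Implicit Types (g : R -> R[i]) (c : R[i]) (u : R -> R).

Lemma complexRM (z y : R[i]) :
  complex.Re (z * y) = complex.Re z * complex.Re y - complex.Im z * complex.Im y.
Proof. by case: z => ? ?; case: y => ? ?. Qed.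

Lemma complexIM (z y : R[i]) :
  complex.Im (z * y) = complex.Re z * complex.Im y + complex.Im z * complex.Re y.
Proof. by case: z => ? ?; case: y => ? ?. Qed.

Lemma complexRD (z y : R[i]) : complex.Re (z + y) = complex.Re z + complex.Re y.
Proof. by case: z => ? ?; case: y => ? ?. Qed.

Lemma complexID (z y : R[i]) : complex.Im (z + y) = complex.Im z + complex.Im y.
Proof. by case: z => ? ?; case: y => ? ?. Qed.

Lemma continuous_curve_cst c : continuous_curve (fun _ => c).
Proof. by split=> t; exact: cvg_cst. Qed.

Lemma continuous_curveD g1 g2 : continuous_curve g1 -> continuous_curve g2 ->
  continuous_curve (fun t => g1 t + g2 t).
Proof.
move=> [r1 i1] [r2 i2]; split=> t.
  under eq_fun => s do rewrite complexRD.
  exact: (continuousD (r1 t) (r2 t)).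
under eq_fun => s do rewrite complexID.
exact: (continuousD (i1 t) (i2 t)).
Qed.

Lemma continuous_curveM g1 g2 : continuous_curve g1 -> continuous_curve g2 ->
  continuous_curve (fun t => g1 t * g2 t).
Proof.
move=> [r1 i1] [r2 i2]; split=> t.
  under eq_fun => s do rewrite complexRM.
  exact: (continuousB (continuousM (r1 t) (r2 t)) (continuousM (i1 t) (i2 t))).
under eq_fun => s do rewrite complexIM.
exact: (continuousD (continuousM (r1 t) (i2 t)) (continuousM (i1 t) (r2 t))).
Qed.

Lemma continuous_curveV g : (forall t, g t != 0) -> continuous_curve g ->
  continuous_curve (fun t => (g t)^-1).
Proof.
move=> g0 [rg ig].
pose n2 t := complex.Re (g t) * complex.Re (g t)
  + complex.Im (g t) * complex.Im (g t).
have n20 t : n2 t != 0.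
  apply: contra (g0 t); rewrite /n2 -!expr2 paddr_eq0 ?sqr_ge0 //.
  by rewrite !sqrf_eq0 eq_complex.
have cn2 : continuous (fun t => (n2 t)^-1).
  move=> t; apply: (continuousV (n20 t)).
  exact: (continuousD (continuousM (rg t) (rg t)) (continuousM (ig t) (ig t))).
have Re_inv t : complex.Re (g t)^-1 = complex.Re (g t) * (n2 t)^-1.
  by rewrite /n2; case: (g t) => p q; rewrite -!expr2.
have Im_inv t : complex.Im (g t)^-1 = - (complex.Im (g t) * (n2 t)^-1).
  by rewrite /n2; case: (g t) => p q; rewrite -!expr2.
split=> t.
  under eq_fun => s do rewrite Re_inv.
  exact: (continuousM (rg t) (cn2 t)).
under eq_fun => s do rewrite Im_inv.
exact: (continuousN (continuousM (ig t) (cn2 t))).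
Qed.

Lemma continuous_curve_prod (I : Type) (s : seq I) (G : I -> R -> R[i]) :
  (forall i, continuous_curve (G i)) ->
  continuous_curve (fun t => \prod_(i <- s) G i t).
Proof.
move=> cG; elim: s => [|i s IH].
  by under eq_fun do rewrite big_nil; exact: continuous_curve_cst.
by under eq_fun do rewrite big_cons; exact: continuous_curveM.
Qed.

Lemma continuous_curveXz g (n : int) : (forall t, g t != 0) ->
  continuous_curve g -> continuous_curve (fun t => g t ^ n).
Proof.
move=> g0 cg.
have cgn k : continuous_curve (fun t => g t ^+ k).
  elim: k => [|k IH].
    by under eq_fun do rewrite expr0; exact: continuous_curve_cst.
  by under eq_fun do rewrite exprS; exact: continuous_curveM.
case: n => k; first exact: cgn.
by apply: continuous_curveV (cgn k.+1) => t; rewrite expf_neq0.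
Qed.

Local Notation leb := (@lebesgue_measure R).
Local Notation period := `[0%R, (2 * pi)%R]%classic (only parsing).

Lemma continuous_integrable_period u : continuous u ->
  leb.-integrable period (EFin \o u).
Proof.
move=> cu; apply: continuous_compact_integrable; first exact: segment_compact.
exact: continuous_subspaceT.
Qed.

Definition curve_integral g : R[i] :=
  ((\int[leb]_(t in period) complex.Re (g t))
   +i* (\int[leb]_(t in period) complex.Im (g t)))%C.

Lemma curve_integralD g1 g2 : continuous_curve g1 -> continuous_curve g2 ->
  curve_integral (fun t => g1 t + g2 t) = curve_integral g1 + curve_integral g2.
Proof.
move=> [r1 i1] [r2 i2]; rewrite /curve_integral.
under eq_Rintegral do rewrite complexRD.
under [X in (_ +i* X)%C]eq_Rintegral do rewrite complexID.
by rewrite !RintegralD //; exact: continuous_integrable_period.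
Qed.

Lemma curve_integralZ c g : continuous_curve g ->
  curve_integral (fun t => c * g t) = c * curve_integral g.
Proof.
case: c => p q [rg ig]; rewrite /curve_integral.
have itg := continuous_integrable_period.
have iZ (s : R) u : continuous u ->
    leb.-integrable period (EFin \o (fun t => s * u t)).
  by move=> cu; apply: itg => t; apply: continuousM (cu t); exact: cvg_cst.
under eq_Rintegral do rewrite complexRM.
under [X in (_ +i* X)%C]eq_Rintegral do rewrite complexIM.
rewrite RintegralB ?RintegralD ?RintegralZl //.
all: by [exact: itg | exact: iZ].
Qed.

Lemma Rintegral_period_eq0 u (F : R -> R) : continuous u ->
  (forall t : R, is_derive t 1 F (u t)) -> F 0 = F (2 * pi) ->
  \int[leb]_(t in period) u t = 0.
Proof.
move=> cu dF F02.
have cF : continuous F.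
  move=> t; apply: differentiable_continuous; apply/derivable1_diffP.
  by have := dF t; case.
rewrite /Rintegral (@continuous_FTC2 _ u F) ?F02 ?subee //.
- by rewrite mulr_gt0 ?pi_gt0.
- exact: continuous_subspaceT.
- split=> [t _||]; first by have := dF t; case.
    by apply: cvg_at_right_filter; exact: cF.
  by apply: cvg_at_left_filter; exact: cF.
- by move=> t _; rewrite derive1E; have := dF t; case.
Qed.

Lemma continuous_curve_norm g : continuous_curve g ->
  continuous (fun t => Normc.normc (g t)).
Proof.
move=> [rg ig] t.
have -> : (fun t => Normc.normc (g t)) = Num.sqrt \o
    (fun t => complex.Re (g t) * complex.Re (g t)
              + complex.Im (g t) * complex.Im (g t)).
  by apply/funext => s /=; case: (g s) => p q.
apply: continuous_comp; last exact: sqrt_continuous.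
exact: (continuousD (continuousM (rg t) (rg t)) (continuousM (ig t) (ig t))).
Qed.

Lemma normc_ge_ReIm (z : R[i]) :
  `|complex.Re z| <= Normc.normc z /\ `|complex.Im z| <= Normc.normc z.
Proof.
case: z => p q /=; rewrite -!sqrtr_sqr.
by split; apply: ler_wsqrtr; rewrite ?lerDl ?lerDr sqr_ge0.
Qed.

Lemma geometric_bound_eq0 (x C rho : R) : 0 <= rho < 1 ->
  (forall K, `|x| <= C * rho ^+ K) -> x = 0.
Proof.
move=> /andP[rho0 rho1] xle; apply/eqP; rewrite -normr_eq0 -normr_le0 normr_id.
have cvC : geometric C rho @ \oo --> 0.
  by apply: cvg_geometric; rewrite ger0_norm.
rewrite -(cvg_lim _ cvC) //; apply: limr_ge; first exact: cvgP cvC.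
by apply: nearW => K; exact: xle.
Qed.

(** An integral that is unchanged when its integrand is multiplied by powers of
    a factor of constant modulus [rho < 1] is bounded by a constant times
    [rho ^+ K] for every [K]. *)
Lemma curve_integral_eq0_decay g (q : R -> R[i]) (rho : R) :
  continuous_curve g -> continuous_curve q -> 0 <= rho < 1 ->
  (forall t, Normc.normc (q t) = rho) ->
  (forall K, curve_integral g = curve_integral (fun t => g t * q t ^+ K)) ->
  curve_integral g = 0.
Proof.
move=> cg cq rho01 qE gE.
have itg := continuous_integrable_period.
pose C := \int[leb]_(t in period) Normc.normc (g t).
have qK K t : Normc.normc (g t * q t ^+ K) = rho ^+ K * Normc.normc (g t).
  rewrite Normc.normcM mulrC; congr (_ * _).
  by elim: K => [|K IH]; rewrite ?Normc.normc1 // !exprS Normc.normcM qE IH.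
have cgq K : continuous_curve (fun t => g t * q t ^+ K).
  elim: K => [|K IH]; first by under eq_fun do rewrite expr0 mulr1.
  by under eq_fun do rewrite exprS mulrCA; exact: continuous_curveM.
have bound K u : continuous u ->
    (forall t, `|u t| <= Normc.normc (g t * q t ^+ K)) ->
    `|\int[leb]_(t in period) u t| <= C * rho ^+ K.
  move=> cu ule; apply: le_trans (le_normr_Rintegral _ (itg _ cu)) _ => //.
  rewrite [C * _]mulrC -RintegralZl //; last exact/itg/continuous_curve_norm.
  apply: le_Rintegral => //.
  - by apply: itg => t; apply: (continuous_comp (cu t)); exact: norm_continuous.
  - have cst : continuous (fun _ : R => rho ^+ K) by move=> t; exact: cvg_cst.
    apply: itg => t.
    exact: (continuousM (cst t) (continuous_curve_norm _ cg t)).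
  - by move=> t _; rewrite -qK.
have Re0 : complex.Re (curve_integral g) = 0.
  apply: (geometric_bound_eq0 _ C rho rho01) => K; rewrite (gE K).
  by apply: bound _ _ (cgq K).1 _ => t; exact: (normc_ge_ReIm _).1.
have Im0 : complex.Im (curve_integral g) = 0.
  apply: (geometric_bound_eq0 _ C rho rho01) => K; rewrite (gE K).
  by apply: bound _ _ (cgq K).2 _ => t; exact: (normc_ge_ReIm _).2.
by apply/eqP; rewrite eq_complex Re0 Im0 !eqxx.
Qed.

End Curves.

Arguments curve_integral {R} g.

Section Circle.
Variable R : realType.
Implicit Types (r s t : R).

Lemma circleM r s t u : circle r s * circle t u = circle (r * t) (s + u).
Proof.
apply/eqP; rewrite eq_complex complexRM complexIM /= cosD sinD.
by apply/andP; split; apply/eqP; ring.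
Qed.

Lemma circle10 : circle 1 (0 : R) = 1.
Proof. by rewrite /circle cos0 sin0 mulr1 mulr0. Qed.

Lemma circle_neq0 r t : 0 < r -> circle r t != 0.
Proof.
move=> r0; apply/eqP => /(congr1 ( *%R^~ (circle r^-1 (- t)))).
rewrite mul0r circleM mulfV ?gt_eqF // subrr circle10 => /eqP.
by rewrite oner_eq0.
Qed.

Lemma circleV r t : 0 < r -> (circle r t)^-1 = circle r^-1 (- t).
Proof.
move=> r0; apply: (mulfI (circle_neq0 r t r0)).
by rewrite mulfV ?circle_neq0 // circleM mulfV ?gt_eqF // subrr circle10.
Qed.

Lemma circleXz r t (n : int) : 0 < r ->
  circle r t ^ n = circle (r ^ n) (n%:~R * t).
Proof.
move=> r0.
have cX (k : nat) : circle r t ^+ k = circle (r ^+ k) (k%:R * t).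
  elim: k => [|k IH]; first by rewrite !expr0 mul0r circle10.
  by rewrite !exprS IH circleM mulrS mulrDl mul1r.
case: n => k; first exact: cX.
rewrite -[_ ^ _]/(_ ^- k.+1) cX circleV ?exprn_gt0 //.
by rewrite NegzE mulrNz mulNr.
Qed.

Lemma circle_continuous r : continuous_curve (circle r).
Proof.
split=> t /=.
- by apply: cvgMl_tmp; exact: continuous_cos.
- by apply: cvgMl_tmp; exact: continuous_sin.
Qed.

Lemma normc_circle r t : 0 <= r -> Normc.normc (circle r t) = r.
Proof.
move=> r0; rewrite /= !exprMn -mulrDr cos2Dsin2 mulr1 sqrtr_sqr.
exact: ger0_norm.
Qed.

Lemma cos_sin_int_period (k : int) :
  cos (k%:~R * (2 * pi)) = 1 :> R /\ sin (k%:~R * (2 * pi)) = 0 :> R.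
Proof.
have natE (n : nat) : cos (n%:R * (2 * pi)) = 1 :> R
    /\ sin (n%:R * (2 * pi)) = 0 :> R.
  rewrite -[n%:R * _]add0r mulr_natl [2 * _]mulr_natl.
  rewrite (periodicn (@cosD2pi R)) (periodicn (@sinD2pi R)).
  by rewrite cos0 sin0.
case: k => n; first exact: natE.
have [cosE sinE] := natE n.+1.
by rewrite NegzE mulrNz mulNr cosN sinN; rewrite cosE sinE oppr0.
Qed.

Lemma is_derive_scale (k t : R) : is_derive t 1 ( *%R k) k.
Proof.
apply: (is_derive_eq (is_deriveZ k (is_derive_id t (1 : R)))).
by rewrite /GRing.scale /= mulr1.
Qed.

Lemma is_derive_cosM (k t : R) :
  is_derive t 1 (fun t : R => cos (k * t)) (- (k * sin (k * t))).
Proof.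
apply: (is_derive_eq (is_derive1_comp (is_derive_cos (k * t)) (is_derive_scale k t))).
by rewrite mulNr mulrC.
Qed.

Lemma is_derive_sinM (k t : R) :
  is_derive t 1 (fun t : R => sin (k * t)) (k * cos (k * t)).
Proof.
apply: (is_derive_eq (is_derive1_comp (is_derive_sin (k * t)) (is_derive_scale k t))).
by rewrite mulrC.
Qed.

End Circle.

(** * Contour integrals of rational functions over a circle *)

Definition contour {R : realType} (r : R) (f : R[i] -> R[i]) : R[i] :=
  ((2 * pi)%:C%C * 'i%C)^-1 * circle_integral r f.

Definition continuous_on_circle {R : realType} (r : R) (f : R[i] -> R[i]) :=
  continuous_curve (fun t => f (circle r t)).

Definition laurent {R : realType} (n : int) (ps qs : seq R) (z : R[i]) : R[i] :=
  z ^ n * (\prod_(p <- ps) (z - p%:C%C)) / \prod_(q <- qs) (z - q%:C%C).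

Section Contour.
Variables (R : realType) (r : R).
Hypothesis r0 : 0 < r.
Implicit Types (f g : R[i] -> R[i]) (c z : R[i]) (n : int) (p q : R).
Implicit Types ps qs : seq R.

Local Notation on_circle z := (Normc.normc z = r).

Lemma on_circle_neq0 z : on_circle z -> z != 0.
Proof.
move=> zr; apply/eqP => z0; move: zr; rewrite z0 Normc.normc0 => /eqP.
by rewrite lt_eqF.
Qed.

Lemma on_circle_sub_neq0 z (q : R) : on_circle z -> `|q| < r -> z - q%:C%C != 0.
Proof.
move=> zr qr; rewrite subr_eq0; apply/eqP => zq; move: zr qr.
by rewrite zq /= expr0n addr0 sqrtr_sqr => ->; rewrite ltxx.
Qed.

Lemma eq_contour f g : (forall z, on_circle z -> f z = g z) ->
  contour r f = contour r g.
Proof.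
move=> fg; have fgt t : f (circle r t) = g (circle r t).
  by apply: fg; apply: normc_circle; exact: ltW.
rewrite /contour /circle_integral; congr (_ * (_ +i* _)%C);
  by apply: eq_Rintegral => t _; rewrite fgt.
Qed.

Lemma circle_integralE f : circle_integral r f =
  curve_integral (fun t => f (circle r t) * ('i%C * circle r t)).
Proof. by []. Qed.

Lemma continuous_circle_weight f : continuous_on_circle r f ->
  continuous_curve (fun t => f (circle r t) * ('i%C * circle r t)).
Proof.
move=> cf; apply: continuous_curveM => //; apply: continuous_curveM.
  exact: continuous_curve_cst.
exact: circle_continuous.
Qed.

Lemma contourD f g : continuous_on_circle r f -> continuous_on_circle r g ->
  contour r (fun z => f z + g z) = contour r f + contour r g.
Proof.
move=> cf cg; rewrite /contour -mulrDr !circle_integralE; congr (_ * _).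
rewrite -curve_integralD; [|exact: continuous_circle_weight..].
by congr curve_integral; apply/funext => t; rewrite mulrDl.
Qed.

Lemma contourZ c f : continuous_on_circle r f ->
  contour r (fun z => c * f z) = c * contour r f.
Proof.
move=> cf; rewrite /contour mulrCA !circle_integralE; congr (_ * _).
rewrite -curve_integralZ; last exact: continuous_circle_weight.
by congr curve_integral; apply/funext => t; rewrite -mulrA.
Qed.

(** The primitives of the cosine and of the sine of [(n + 1) t] are periodic
    except when [n = -1], where the integrand of the parametrized integral is
    constant. *)
Lemma contour_expz (n : int) : contour r (fun z => z ^ n) = (n == -1)%:R.
Proof.
have gE t : circle r t ^ n * ('i%C * circle r t) =
    'i%C * circle (r ^ (n + 1)) ((n + 1)%:~R * t).
  rewrite circleXz // mulrCA circleM expfzDr ?gt_eqF // expr1z.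
  by rewrite intrD mulrDl mul1r.
have ReE t : complex.Re (circle r t ^ n * ('i%C * circle r t)) =
    - (r ^ (n + 1) * sin ((n + 1)%:~R * t)).
  by rewrite gE complexRM /=; ring.
have ImE t : complex.Im (circle r t ^ n * ('i%C * circle r t)) =
    r ^ (n + 1) * cos ((n + 1)%:~R * t).
  by rewrite gE complexIM /=; ring.
have pi2 : (2 * pi)%:C%C * 'i%C != 0 :> R[i].
  rewrite mulf_neq0 // eq_complex /=; last by rewrite oner_eq0 andbF.
  by rewrite eqxx andbT gt_eqF // mulr_gt0 ?pi_gt0.
rewrite /contour circle_integralE.
have [n1|n1] := eqVneq n (-1).
  rewrite [curve_integral _](_ : _ = curve_integral (fun=> 'i%C)); last first.
    congr curve_integral; apply/funext => t.
    by rewrite gE n1 addNr expr0z mul0r circle10 mulr1.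
  rewrite /curve_integral /=.
  rewrite !Rintegral_cst //= lebesgue_measure_itv /= lte_fin mulr_gt0 ?pi_gt0 //.
  rewrite mul0r mul1r -EFinD /= subr0.
  rewrite [X in _ * X](_ : _ = (2 * pi)%:C%C * 'i%C) ?mulVf //.
  apply/eqP; rewrite eq_complex complexRM complexIM /=.
  by apply/andP; split; apply/eqP; ring.
rewrite [curve_integral _](_ : _ =
  (\int[lebesgue_measure]_(t in `[0%R, (2 * pi)%R])
     - (r ^ (n + 1) * sin ((n + 1)%:~R * t))
   +i* (\int[lebesgue_measure]_(t in `[0%R, (2 * pi)%R])
     (r ^ (n + 1) * cos ((n + 1)%:~R * t))))%C); last first.
  by congr (_ +i* _)%C; apply: eq_Rintegral => t _.
have [kcos1 ksin0] := cos_sin_int_period R (n + 1).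
set k : R := (n + 1)%:~R.
have k0 : k != 0 by rewrite intr_eq0 addr_eq0.
set c := r ^ (n + 1).
have cst (a : R) : continuous (fun _ : R => a) by move=> t; exact: cvg_cst.
have ck : continuous ( *%R k) by move=> t; exact: mulrl_continuous.
have sk : continuous (fun t : R => sin (k * t)).
  by move=> t; apply: (continuous_comp (ck t)); exact: continuous_sin.
have cosk : continuous (fun t : R => cos (k * t)).
  by move=> t; apply: (continuous_comp (ck t)); exact: continuous_cos.
have cs : continuous (fun t : R => - (c * sin (k * t))).
  by move=> t; exact: (continuousN (continuousM (cst c t) (sk t))).
have cc : continuous (fun t : R => c * cos (k * t)).
  by move=> t; exact: (continuousM (cst c t) (cosk t)).
have ds (t : R) :
    is_derive t 1 (fun t : R => c / k * cos (k * t)) (- (c * sin (k * t))).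
  apply: (is_derive_eq (is_deriveZ (c / k) (is_derive_cosM R k t))).
  by rewrite -[LHS]/(c / k * - (k * sin (k * t))) mulrN mulrA divfK.
have dc (t : R) : is_derive t 1 (fun t : R => c / k * sin (k * t)) (c * cos (k * t)).
  apply: (is_derive_eq (is_deriveZ (c / k) (is_derive_sinM R k t))).
  by rewrite -[LHS]/(c / k * (k * cos (k * t))) mulrA divfK.
rewrite (Rintegral_period_eq0 _ _ _ cs ds); last by rewrite mulr0 cos0 kcos1.
rewrite (Rintegral_period_eq0 _ _ _ cc dc); last by rewrite mulr0 sin0 ksin0.
by rewrite mulr0.
Qed.

Lemma continuous_laurent (n : int) (ps qs : seq R) :
  all (fun q => `|q| < r) qs -> continuous_on_circle r (laurent n ps qs).
Proof.
move=> qsr.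
have clin (p : R) : continuous_curve (fun t => circle r t - p%:C%C).
  apply: continuous_curveD; first exact: circle_continuous.
  exact: continuous_curve_cst.
apply: continuous_curveM.
  apply: continuous_curveM; last exact: continuous_curve_prod.
  apply: continuous_curveXz; last exact: circle_continuous.
  by move=> t; exact: circle_neq0.
apply: continuous_curveV; last exact: continuous_curve_prod.
move=> t; rewrite prodf_seq_neq0; apply/allP => q /(allP qsr) qr /=.
by apply: on_circle_sub_neq0 => //; apply: normc_circle; exact: ltW.
Qed.

Lemma laurent_pole n ps q qs z : on_circle z -> `|q| < r ->
  laurent n ps (q :: qs) z =
  laurent (n - 1) ps qs z + q%:C%C * laurent (n - 1) ps (q :: qs) z.
Proof.
move=> zr qr; have z0 := on_circle_neq0 _ zr.
have zq := on_circle_sub_neq0 _ _ zr qr.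
rewrite /laurent !big_cons !invfM -[in LHS](subrK 1 n) expfzDr // expr1z.
set A := z ^ _; set B := \prod_(_ <- _) _; set D := (\prod_(_ <- _) _)^-1.
by field.
Qed.

(** From [z / (z - q) = 1 + q / (z - q)]. *)
Lemma contour_laurent_pole n ps q qs : all (fun q => `|q| < r) (q :: qs) ->
  contour r (laurent n ps (q :: qs)) =
  contour r (laurent (n - 1) ps qs)
    + q%:C%C * contour r (laurent (n - 1) ps (q :: qs)).
Proof.
move=> qqs; have /andP[qr qsr] := qqs.
rewrite -contourZ; last exact: continuous_laurent.
rewrite -contourD; [|exact: continuous_laurent|]; last first.
  apply: continuous_curveM; first exact: continuous_curve_cst.
  exact: continuous_laurent.
by apply: eq_contour => z zr; exact: laurent_pole.
Qed.

Lemma contour_laurent_zero n p ps qs : all (fun q => `|q| < r) qs ->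
  contour r (laurent n (p :: ps) qs) =
  contour r (laurent (n + 1) ps qs) + (- p%:C%C) * contour r (laurent n ps qs).
Proof.
move=> qsr; rewrite -contourZ; last exact: continuous_laurent.
rewrite -contourD; [|exact: continuous_laurent|]; last first.
  apply: continuous_curveM; first exact: continuous_curve_cst.
  exact: continuous_laurent.
apply: eq_contour => z zr; rewrite /laurent big_cons.
rewrite expfzDr ?on_circle_neq0 // expr1z.
set A := z ^ _; set B := \prod_(_ <- _) _; set D := (\prod_(_ <- _) _)^-1.
by ring.
Qed.

Lemma contour_decay f (q : R) : continuous_on_circle r f -> `|q| < r ->
  (forall K, contour r f = contour r (fun z => f z * (q%:C%C / z) ^+ K)) ->
  contour r f = 0.
Proof.
move=> cf qr fE.
have ciq : continuous_curve (fun t => q%:C%C / circle r t).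
  apply: continuous_curveM; first exact: continuous_curve_cst.
  apply: continuous_curveV; last exact: circle_continuous.
  by move=> t; exact: circle_neq0.
rewrite /contour circle_integralE (_ : curve_integral _ = 0) ?mulr0 //.
apply: (@curve_integral_eq0_decay _ _ _ (`|q| / r) _ ciq).
- exact: continuous_circle_weight.
- by rewrite divr_ge0 ?normr_ge0 ?ltW //= ltr_pdivrMr // mul1r.
- move=> t; rewrite Normc.normcM Normc.normcV normc_circle ?ltW //.
  by rewrite /= expr0n addr0 sqrtr_sqr.
- move=> K; have := fE K; rewrite /contour !circle_integralE => /mulfI -> //.
    by congr curve_integral; apply/funext => t; rewrite mulrAC.
  rewrite invr_neq0 // mulf_neq0 // eq_complex /=; last by rewrite oner_eq0 andbF.
  by rewrite eqxx andbT gt_eqF // mulr_gt0 ?pi_gt0.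
Qed.

(** Zeros are expanded one at a time. With poles only, [contour_laurent_pole]
    and induction on their number give [I n = q * I (n - 1)] for the integrals
    [I n] with a fixed set of poles and [n] in the range considered. So the
    integral is unchanged when the integrand is multiplied by [q / z], and it is
    zero because [q] has modulus less than [r]. *)
Lemma contour_laurent_eq0 (n : int) ps qs : all (fun q => `|q| < r) qs ->
  n + (size ps)%:Z - (size qs)%:Z <= - 2%:Z -> contour r (laurent n ps qs) = 0.
Proof.
move=> qsr; elim: ps n => [|p ps IHp] n /=; last first.
  move=> deg; rewrite contour_laurent_zero // !IHp; [by rewrite mulr0 addr0|lia|lia].
elim: qs qsr n => [|q qs IHq] /= qqsr n deg.
  rewrite (eq_contour _ (fun z => z ^ n)); last first.
    by move=> z _; rewrite /laurent !big_nil invr1 !mulr1.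
  by rewrite contour_expz; have -> : (n == -1) = false by lia.
have /andP[qr qsr] := qqsr.
apply: (@contour_decay _ q) => //; first exact: continuous_laurent.
move=> K.
have -> : contour r (fun z => laurent n [::] (q :: qs) z * (q%:C%C / z) ^+ K) =
    q%:C%C ^+ K * contour r (laurent (n - K%:Z) [::] (q :: qs)).
  rewrite -contourZ; last exact: continuous_laurent.
  apply: eq_contour => z zr; have z0 := on_circle_neq0 _ zr.
  rewrite /laurent expfzDr // exprMn exprVn -exprnN.
  by rewrite mulrCA; congr (_ * _); rewrite (mulrAC _ (z ^- K)) (mulrAC _ (z ^- K)).
elim: K => [|K ->]; first by rewrite expr0 mul1r subr0.
rewrite (contour_laurent_pole (n - K%:Z)) // IHq ?add0r //; last by lia.
by rewrite exprSr mulrA; have -> : n - K.+1%:Z = n - K%:Z - 1 by lia.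
Qed.

Lemma contour_polynomial_eq0 (n : int) ps : 0 <= n ->
  contour r (laurent n ps [::]) = 0.
Proof.
elim: ps n => [|p ps IH] n n0.
  rewrite (eq_contour _ (fun z => z ^ n)); last first.
    by move=> z _; rewrite /laurent !big_nil invr1 !mulr1.
  by rewrite contour_expz; have -> : (n == -1) = false by lia.
by rewrite contour_laurent_zero // !IH ?mulr0 ?addr0 //; lia.
Qed.

Lemma contour_simple_pole (n : nat) (q : R) : `|q| < r ->
  contour r (laurent n%:Z [::] [:: q]) = q%:C%C ^+ n.
Proof.
move=> qr; have qsr : all (fun q => `|q| < r) [:: q] by rewrite /= qr.
have expzE (k : int) : contour r (laurent k [::] [::]) = (k == -1)%:R.
  rewrite -contour_expz; apply: eq_contour => z _.
  by rewrite /laurent !big_nil invr1 !mulr1.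
elim: n => [|n IH]; rewrite contour_laurent_pole // expzE.
  by rewrite contour_laurent_eq0 ?mulr0 ?addr0.
have -> : n.+1%:Z - 1 = n%:Z by lia.
by rewrite IH exprS add0r.
Qed.

End Contour.

(** * The matrix entries *)

Section Entries.
Variables (R : realType) (a b : nat -> R) (x : nat -> int) (N : nat) (r : R).
Hypothesis a_ge0 : forall i, (0 < i)%N -> 0 <= a i.
Hypothesis b_gt0 : forall j, (0 < j)%N -> 0 < b j.
Hypothesis ab_lt1 : forall i j, (0 < i)%N -> (0 < j)%N -> a i * b j < 1.
Hypothesis N_gt0 : (0 < N)%N.
Hypothesis r_gt : forall j, (0 < j <= N)%N -> (b j)^-1 < r.

Lemma radius_gt0 : 0 < r.
Proof.
have := r_gt 1 N_gt0; apply: le_lt_trans.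
by rewrite invr_ge0 ltW // b_gt0.
Qed.
Let r0 := radius_gt0.

Lemma radius_gt_a i : (0 < i)%N -> `|a i| < r.
Proof.
move=> i0; rewrite ger0_norm ?a_ge0 //; apply: lt_trans (r_gt 1 N_gt0).
by rewrite -div1r ltr_pdivlMr ?b_gt0 // ab_lt1.
Qed.

Lemma radius_gt_binv j : (0 < j <= N)%N -> `|(b j)^-1| < r.
Proof.
move=> jN; have /andP[j0 _] := jN.
by rewrite ger0_norm ?r_gt // invr_ge0 ltW // b_gt0.
Qed.

Lemma b_neq0 j : (0 < j)%N -> (b j)%:C%C != 0 :> R[i].
Proof. by move=> j0; rewrite eq_complex /= eqxx andbT gt_eqF // b_gt0. Qed.

Definition zeros (j : nat) : seq R := [seq (b k)^-1 | k <- index_iota 1 j].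

Definition poles (m i : nat) : seq R :=
  [seq a k | k <- index_iota 1 m.+1] ++ zeros i.+1.

(** The part of the integrand that is constant in [z]. *)
Definition entry_scale (m i j : nat) (h : int) : R[i] :=
  (b j)%:C%C ^ (h - 1) / (b i)%:C%C ^ (x i) *
  \prod_(1 <= k < m.+1) (1 - (a k * b j)%:C%C).

Definition entry (m i j : nat) (h : int) : R[i] :=
  F_entry a b x (fun=> h) m r i j.

Lemma poles_lt m i : (0 < i <= N)%N -> all (fun q => `|q| < r) (poles m i).
Proof.
move=> iN; rewrite all_cat; apply/andP; split; apply/allP => q /mapP[k];
  rewrite mem_index_iota => k1 ->.
  by apply: radius_gt_a; lia.
by apply: radius_gt_binv; lia.
Qed.

(** Isolates the dependence on [z]: the factors [1 - a_k / z] become [m] poles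
    at the [a_k] and [m] additional powers of [z]. *)
Lemma entryE m i j (h : int) : (0 < i <= N)%N -> (0 < j)%N ->
  entry m i j h = entry_scale m i j h *
    contour r (laurent (h - 1 - x i + m%:Z) (zeros j) (poles m i)).
Proof.
move=> iN j0; rewrite -contourZ //; last exact/continuous_laurent/poles_lt.
rewrite /entry /F_entry -/(contour r _); apply: eq_contour => // z zr.
have z0 := on_circle_neq0 _ _ r0 _ zr.
have bi0 : (b i)%:C%C != 0 :> R[i] by apply: b_neq0; lia.
have bj0 : (b j)%:C%C != 0 :> R[i] by exact: b_neq0.
have geo : \prod_(1 <= k < m.+1) ((1 - (a k * b j)%:C%C) / (1 - (a k)%:C%C / z)) =
    \prod_(1 <= k < m.+1) (1 - (a k * b j)%:C%C) * z ^+ m /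
    \prod_(1 <= k < m.+1) (z - (a k)%:C%C).
  elim: m {h} => [|m IH]; first by rewrite !big_geq // invr1 !mulr1.
  rewrite !(big_nat_recr m.+1) //= IH exprSr.
  have za : z - (a m.+1)%:C%C != 0
    by apply: (on_circle_sub_neq0 _ _ _ _ zr); exact: radius_gt_a.
  have -> : 1 - (a m.+1)%:C%C / z = (z - (a m.+1)%:C%C) / z by rewrite mulrBl divff.
  rewrite !invfM invrK.
  have alg (A zm D c d y : R[i]) :
      A * zm * D * (c * (d * y)) = A * c * (zm * y) * (D * d) by ring.
  exact: alg.
rewrite geo /laurent /entry_scale /poles big_cat /= !big_map.
rewrite !expfzMl ?bi0 // !expfzDr //.
rewrite -exprnP -(invr_expz z (x i)) !invfM.
have alg (zh z' bh b' zx bx p q A zm D : R[i]) :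
    zh * z' * (bh * b') * (zx * bx) * (p * q) * (A * zm * D) =
    bh * b' * bx * A * (zh * z' * zx * zm * p * (D * q)) by ring.
exact: alg.
Qed.

Lemma laurent_poles_recr n ps m i z :
  laurent n ps (poles m.+1 i) z = laurent n ps (a m.+1 :: poles m i) z.
Proof.
rewrite /laurent big_cons /poles !big_cat !big_map (big_nat_recr m.+1) //=.
by congr (_ / _); rewrite mulrAC mulrC.
Qed.

(** [contour_laurent_pole] for the pole [a m.+1]; the term without this pole is
    the entry for [m], and the term with it is the entry for [m.+1] and [h - 1]. *)
Lemma entry_step m i j (h : int) : (0 < i <= N)%N -> (0 < j <= N)%N ->
  entry m.+1 i j h = (1 - (a m.+1 * b j)%:C%C) * entry m i j h
    + (a m.+1 * b j)%:C%C * entry m.+1 i j (h - 1).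
Proof.
move=> iN /andP[j0 jN]; rewrite !entryE //.
pose e := h - 1 - x i + m%:Z.
have -> : h - 1 - x i + m.+1%:Z = e + 1 by rewrite /e; lia.
have -> : h - 1 - 1 - x i + m.+1%:Z = e by rewrite /e; lia.
have recr n : contour r (laurent n (zeros j) (poles m.+1 i)) =
    contour r (laurent n (zeros j) (a m.+1 :: poles m i)).
  by apply: eq_contour => // z _; exact: laurent_poles_recr.
rewrite !recr contour_laurent_pole //; last first.
  by rewrite /= radius_gt_a //=; exact: poles_lt.
rewrite addrK -/e.
have scale_m : entry_scale m.+1 i j h =
    (1 - (a m.+1 * b j)%:C%C) * entry_scale m i j h.
  by rewrite /entry_scale (big_nat_recr m.+1) //= mulrA mulrC.
have scale_h : (b j)%:C%C * entry_scale m.+1 i j (h - 1) = entry_scale m.+1 i j h.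
  rewrite /entry_scale !mulrA; do 2!congr (_ * _).
  by rewrite -[X in X * _ = _]expr1z -expfzDr ?b_neq0 // addrC subrK.
rewrite mulrDr; congr (_ + _); first by rewrite scale_m -mulrA.
by rewrite -scale_h rmorphM /= mulrACA [(a _)%:C%C * _]mulrC -!mulrA.
Qed.

(** The factor from the integrand of column [j.+1] to the increment in [h] of the
    integrand of column [j]. *)
Definition next_scale (m j : nat) (h : int) : R[i] :=
  (b j)%:C%C * ((b j)%:C%C / (b j.+1)%:C%C) ^ (h - 1) *
  (\prod_(1 <= k < m.+1) (1 - (a k * b j)%:C%C) /
   \prod_(1 <= k < m.+1) (1 - (a k * b j.+1)%:C%C)).

(** Raising the threshold by one multiplies the integrand by [z b_j], and
    [z b_j - 1] is proportional to [z - 1 / b_j], the factor which column [j.+1] has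
    in addition to those of column [j]. *)
Lemma entry_next m i j (h : int) : (0 < i <= N)%N -> (0 < j < N)%N ->
  entry m i j (h + 1) = entry m i j h + entry m i j.+1 h * next_scale m j h.
Proof.
move=> iN /andP[j0 jN]; rewrite !entryE //.
pose e := h - 1 - x i + m%:Z.
have -> : h + 1 - 1 - x i + m%:Z = e + 1 by rewrite /e; lia.
rewrite -/e.
have -> : contour r (laurent e (zeros j.+1) (poles m i)) =
    contour r (laurent e ((b j)^-1 :: zeros j) (poles m i)).
  apply: eq_contour => // z _; rewrite /laurent big_cons !big_map.
  by rewrite big_nat_recr //= [X in _ * X / _]mulrC.
rewrite contour_laurent_zero //; last exact: poles_lt.
have next_S : entry_scale m i j.+1 h * next_scale m j h = entry_scale m i j (h + 1).
  have ratio : ((b j)%:C%C / (b j.+1)%:C%C : R[i]) ^ (h - 1) =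
      (b j)%:C%C ^ (h - 1) / (b j.+1)%:C%C ^ (h - 1).
    by rewrite expfzMl exprz_inv invr_expz.
  have bh : (b j)%:C%C ^ (h + 1 - 1) = (b j)%:C%C * (b j)%:C%C ^ (h - 1) :> R[i].
    by rewrite -[X in _ = X * _]expr1z -expfzDr ?b_neq0 //; congr (_ ^ _); lia.
  rewrite /next_scale /entry_scale ratio bh.
  have alg (B u v X s t : R[i]) : v != 0 -> t != 0 ->
      v * X * t * (B * (u / v) * (s / t)) = B * u * X * s.
    by move=> v0 t0; field; rewrite v0 t0.
  apply: alg; first by rewrite expfz_neq0 ?b_neq0.
  rewrite prodf_seq_neq0; apply/allP => k; rewrite mem_index_iota => /andP[k0 _] /=.
  rewrite subr_eq0 eq_sym eq_complex /= eqxx andbT lt_eqF //.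
  exact: ab_lt1.
have scale_h : entry_scale m i j (h + 1) * ((b j)^-1)%:C%C = entry_scale m i j h.
  have alg (B C X s t : R[i]) : B * t = C -> B * X * s * t = C * X * s.
    by move=> <-; ring.
  rewrite /entry_scale; apply: alg.
  have -> : ((b j)^-1)%:C%C = (b j)%:C%C ^ (-1) :> R[i].
    by rewrite fmorphV -invr_expz expr1z.
  by rewrite -expfzDr ?b_neq0 //; congr (_ ^ _); lia.
have alg (s S S' t c C D : R[i]) : S * t = s -> s * c = S' ->
    s * C = S' * D + S * (C + - c * D) * t.
  by move=> <- <-; ring.
exact: alg.
Qed.

(** The bound on [h] says that the integrand decays at least like [z ^ (-2)]. *)
Lemma entry_eq0 m i j (h : int) : (0 < i <= N)%N -> (0 < j)%N ->
  h <= x i + i%:Z - j%:Z -> entry m i j h = 0.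
Proof.
move=> iN j0 hle; rewrite entryE // contour_laurent_eq0 ?mulr0 //.
  exact: poles_lt.
by rewrite /poles size_cat !size_map !size_iota; lia.
Qed.

(** All the poles cancel and the integrand is a polynomial. *)
Lemma entry0_upper i j (h : int) : (0 < i <= N)%N -> (i < j)%N -> x i < h ->
  entry 0 i j h = 0.
Proof.
move=> iN ij xh; rewrite entryE //; last lia.
rewrite (@eq_contour _ _ r0 _ (laurent (h - 1 - x i)
  [seq (b k)^-1 | k <- index_iota i.+1 j] [::])) ?contour_polynomial_eq0 ?mulr0 //.
  by lia.
move=> z zr; rewrite /laurent /poles /zeros big_cat !big_map !big_nil.
rewrite (@big_cat_nat _ _ _ i.+1 1 j) //= mul1r invr1 mulr1 addr0 -!mulrA.
have Q0 : \prod_(1 <= k < i.+1) (z - ((b k)^-1)%:C%C) != 0.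
  rewrite prodf_seq_neq0; apply/allP => k; rewrite mem_index_iota => k1 /=.
  by apply: (on_circle_sub_neq0 _ _ _ _ zr); apply: radius_gt_binv; lia.
by rewrite [X in _ * X]mulrC mulfVK.
Qed.

Lemma entry0_diag i (h : int) : (0 < i <= N)%N -> x i < h -> entry 0 i i h = 1.
Proof.
move=> iN xh; rewrite entryE //; last lia.
have bi0 : (b i)%:C%C != 0 :> R[i] by apply: b_neq0; lia.
have [n nE] : exists n : nat, h - 1 - x i = n%:Z by exists `|(h - 1 - x i)%R|%N; lia.
rewrite (@eq_contour _ _ r0 _ (laurent n%:Z [::] [:: (b i)^-1])); last first.
  move=> z zr; rewrite /laurent /poles /zeros big_cat !big_map !big_nil.
  rewrite big_seq1 /= mul1r mulr1 addr0 nE (big_nat_recr i) //=; last lia.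
  have P0 : \prod_(1 <= k < i) (z - ((b k)^-1)%:C%C) != 0.
    rewrite prodf_seq_neq0; apply/allP => k; rewrite mem_index_iota => k1 /=.
    by apply: (on_circle_sub_neq0 _ _ _ _ zr); apply: radius_gt_binv; lia.
  by rewrite invfM mulrA mulfK.
rewrite contour_simple_pole ?radius_gt_binv //.
rewrite /entry_scale big_geq // mulr1.
rewrite invr_expz -expfzDr // nE fmorphV exprVn -exprnP divff //.
by rewrite expf_neq0.
Qed.

(** If [x j.+1 < H j.+1] for all [j], the matrix is lower unitriangular, as
    [x i < H i <= H k] for [i < k]. If the inequality fails at [j], then
    [H k <= H j <= x j <= x i] for [k <= j <= i], which is a zero block. *)
Lemma det_entry0 H : in_W N x -> in_W N H ->
  \det (\matrix_(i < N, k < N) entry 0 i.+1 k.+1 (H k.+1)) =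
  [forall j : 'I_N, x j.+1 < H j.+1]%:R.
Proof.
move=> xW HW; case: (boolP [forall j : 'I_N, _]) => [/forallP xH|].
  rewrite det_trig ?big1 // => [i _|].
    by rewrite mxE entry0_diag //; have := ltn_ord i; lia.
  apply/is_trig_mxP => i k ik; rewrite mxE entry0_upper //.
    by have := ltn_ord i; lia.
  apply: lt_le_trans (xH i) _; apply: (@in_W_le N) => //.
  exact: ltnW.
rewrite negb_forall => /existsP[j]; rewrite -leNgt => Hx.
apply: (det_zero_block _ _ _ j) => i k /andP[kj ji].
rewrite mxE entry_eq0 //; first by have := ltn_ord i; lia.
have := @in_W_le N H k.+1 j.+1 HW isT kj (ltn_ord j).
have := @in_W_le N x j.+1 i.+1 xW isT ji (ltn_ord i).
lia.
Qed.

End Entries.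

(** * The growth function and the geometric weights *)

Section Growth.
Variables (g0 : int) (x : nat -> int) (v : nat -> nat -> nat) (N : nat).
Local Notation G := (growth g0 x v).

Lemma growth_ge_left m j : G m j.+1 <= G m.+1 j.+1.
Proof. by rewrite growthSS; lia. Qed.

Lemma growth_ge_below m j : G m.+1 j <= G m.+1 j.+1.
Proof. by rewrite growthSS; lia. Qed.

Lemma growth_ge_init m j : x j.+1 <= G m j.+1.
Proof. by elim: m => [//|m IH]; apply: le_trans IH (growth_ge_left m j). Qed.

Hypotheses (xW : in_W N x) (g0x : g0 <= x 1%N).

Lemma growth_in_W m : in_W N (G m).
Proof. by case: m => [|m] // j _ _; exact: growth_ge_below. Qed.

(** In the first column the maximum is the value in the previous row, since the
    boundary value is at most [x 1]. *)
Lemma growth_site_lt m j c :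
  (G m.+1 j.+1 < c) = (G m j.+1 + (v m.+1 j.+1)%:Z < c) &&
    ((0 < j)%N ==> (G m.+1 j + (v m.+1 j.+1)%:Z < c)).
Proof.
case: j => [|j]; rewrite growthSS ?growthSn0; last by lia.
by have := growth_ge_init m 0; lia.
Qed.

(** Taking the maximum over the two neighbours turns the bound at the new site
    into bounds at both of them. The bound at the left neighbour extends to the
    whole new row by monotonicity. *)
Lemma growth_stair_iff M j (H : nat -> int) : (j < N)%N -> in_W N H ->
  (forall i, (0 < i <= N)%N -> G (stair M j.+1 i) i < H i) <->
  (forall i, (0 < i <= N)%N ->
     G (stair M j i) i < lower j.+1 (H j.+1 - (v M.+1 j.+1)%:Z) H i).
Proof.
move=> jN HW.
have cases i : [\/ (i <= j)%N, i = j.+1 | (j.+1 < i)%N].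
  by have [ij|ij|->] := ltngtP i j.+1; [constructor 1|constructor 3|constructor 2].
split=> GH i iN.
- have := GH j.+1 jN; rewrite stair_le // growth_site_lt => /andP[GHj GHj'].
  have := GH i iN; case: (cases i) => [ij|->|ij].
  + rewrite !stair_le ?lower_le ?leqW // => GHi.
    have Gij : G M.+1 i <= G M.+1 j.
      by apply: (in_W_le _ _ _ _ (growth_in_W M.+1)); lia.
    have j0 : (0 < j)%N by lia.
    by move: GHj'; rewrite j0 implyTb; lia.
  + by rewrite (stair_gt M j j.+1) // lower_at; lia.
  + by rewrite !stair_gt ?lower_gt ?(ltnW ij).
- have := GH j.+1 jN; rewrite stair_gt // lower_at => GHj.
  have := GH i iN; case: (cases i) => [ij|->|ij].
  + by rewrite !stair_le ?lower_le ?leqW //; lia.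
  + move=> _; rewrite (stair_le M j.+1 j.+1) // growth_site_lt.
    apply/andP; split; first lia; apply/implyP => j0.
    by have := GH j; rewrite stair_le // lower_le // => /(_ ltac:(lia)); lia.
  + by rewrite !stair_gt ?lower_gt ?(ltnW ij).
Qed.

End Growth.

Section Cylinder.
Variables (R : realType) (d : measure_display) (T : measurableType d).
Variables (P : probability T R) (w : nat -> nat -> {RV P >-> nat}).

Definition cylinder (s : seq (nat * nat)) (A : nat * nat -> set nat) : set T :=
  \bigcap_(ij in [set` s]) (w ij.1 ij.2 @^-1` A ij).

Lemma measurable_weight i j (A : set nat) : measurable (w i j @^-1` A).
Proof. by rewrite -[X in measurable X]setTI; exact: measurable_funP. Qed.

Lemma measurable_cylinder s A : measurable (cylinder s A).
Proof.
rewrite /cylinder; elim: s => [|ij s IH].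
  by rewrite (_ : [set` _] = set0) ?bigcap_set0 //; apply/seteqP; split.
rewrite (_ : [set` _] = ij |` [set` s]); last first.
  apply/seteqP; split=> kl /=; rewrite inE; first by move/orP => [/eqP|]; [left|right].
  by move=> [/= ->|/= ->]; rewrite ?eqxx ?orbT.
by rewrite bigcap_setU1; apply: measurableI => //; exact: measurable_weight.
Qed.

Lemma cylinder_cons ij k s A : ij \notin s ->
  cylinder (ij :: s) (fun kl => if kl == ij then [set k] else A kl) =
  (w ij.1 ij.2 @^-1` [set k]) `&` cylinder s A.
Proof.
move=> ijs; apply/seteqP; split=> t /=.
  move=> Ct; split; first by have := Ct ij; rewrite /= inE eqxx => /(_ isT).
  move=> kl kls; have := Ct kl; rewrite /= inE kls orbT => /(_ isT).
  case: (eqVneq kl ij) => [klij|//] _.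
  by move: kls; rewrite klij /= (negPf ijs).
move=> [wk Ct] kl /=; rewrite inE; case: eqP => [-> _ //|_ /= kls].
exact: Ct.
Qed.

End Cylinder.

Arguments cylinder {R d T P} w s A.

Section Process.
Variables (R : realType) (d : measure_display) (T : measurableType d).
Variables (P : probability T R) (a b : nat -> R) (w : nat -> nat -> {RV P >-> nat}).
Hypothesis a_ge0 : forall i, (0 < i)%N -> 0 <= a i.
Hypothesis b_gt0 : forall j, (0 < j)%N -> 0 < b j.
Hypothesis ab_lt1 : forall i j, (0 < i)%N -> (0 < j)%N -> a i * b j < 1.
Hypothesis hw : geometric_weights a b w.
Variables (N : nat) (x : nat -> int) (g0 : int) (r : R).
Hypothesis N_gt0 : (0 < N)%N.
Hypothesis xW : in_W N x.
Hypothesis g0x : g0 <= x 1%N.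
Hypothesis r_gt : forall j, (0 < j <= N)%N -> (b j)^-1 < r.

Local Notation U := (entry R a b x r).
Local Notation D := (stair_det R[i] N U).
Local Notation G t := (growth g0 x (fun i j => w i j t)).
Local Notation prob X := ((fine (P X))%:C%C).

Definition stair_event (M j : nat) (H : nat -> int) : set T :=
  [set t | forall i, (0 < i <= N)%N -> G t (stair M j i) i < H i].

(** The order in which the sites are revealed: [ij] comes after (M+1, j). *)
Definition later (M j : nat) (ij : nat * nat) : bool :=
  (0 < ij.2)%N && ((M.+1 < ij.1)%N || (ij.1 == M.+1) && (j < ij.2)%N).

(** The weight at a new site is independent of a cylinder on other sites: both
    sides are products over the sites by mutual independence. *)
Lemma prob_cylinder_cons ij k s A :
  uniq (ij :: s) -> all (fun kl => (0 < kl.1)%N && (0 < kl.2)%N) (ij :: s) ->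
  prob (w ij.1 ij.2 @^-1` [set k] `&` cylinder w s A) =
  ((1 - a ij.1 * b ij.2) * (a ij.1 * b ij.2) ^+ k)%:C%C * prob (cylinder w s A).
Proof.
move=> us ps; have /andP[ijs us'] := us; have /andP[/andP[i0 j0] ps'] := ps.
have [ind geom] := hw.
have -> : P (w ij.1 ij.2 @^-1` [set k] `&` cylinder w s A) =
    (((1 - a ij.1 * b ij.2) * (a ij.1 * b ij.2) ^+ k)%:E * P (cylinder w s A))%E.
  rewrite -cylinder_cons // /cylinder (ind _ us ps) // (ind _ us' ps') //.
  rewrite big_cons eqxx geom //; congr (_ * _)%E.
  apply: eq_big_seq => kl kls; case: (eqVneq kl ij) => [klij|//].
  by move: kls; rewrite klij (negPf ijs).
rewrite fineM //= ?rmorphM //.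
by apply: fin_num_measure; exact: measurable_cylinder.
Qed.

Lemma stair_event_iff M j (H : nat -> int) t : (j < N)%N -> in_W N H ->
  stair_event M j.+1 H t <->
  stair_event M j (lower j.+1 (H j.+1 - (w M.+1 j.+1 t)%:Z) H) t.
Proof. by move=> jN HW; apply: growth_stair_iff. Qed.

Lemma stair_event_weight_lt M j (H : nat -> int) t : (j < N)%N ->
  stair_event M j.+1 H t -> (w M.+1 j.+1 t)%:Z < H j.+1 - x j.+1.
Proof.
move=> jN Ht; have := Ht j.+1 jN; rewrite stair_le // growth_site_lt // => /andP[+ _].
have := growth_ge_init g0 x (fun i j => w i j t) M j; lia.
Qed.

(** The union is finite because the growth function at the new site is at least
    [x j.+1] plus the weight there, hence reaches the threshold [H j.+1] as soon as
    the weight is at least [K]. *)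
Lemma stair_eventE M j (H : nat -> int) K : (j < N)%N -> in_W N H ->
  H j.+1 - K%:Z <= x j.+1 ->
  stair_event M j.+1 H = \big[setU/set0]_(k < K)
    (stair_event M j (lower j.+1 (H j.+1 - k%:Z) H)
     `&` w M.+1 j.+1 @^-1` [set nat_of_ord k]).
Proof.
move=> jN HW HK; rewrite -(bigcup_mkord K (fun k =>
  stair_event M j (lower j.+1 (H j.+1 - k%:Z) H) `&` w M.+1 j.+1 @^-1` [set k])).
apply/seteqP; split=> t.
  move=> Ht; have wK := stair_event_weight_lt _ _ _ _ jN Ht.
  have {}wK : (w M.+1 j.+1 t < K)%N by lia.
  exists (w M.+1 j.+1 t) => //=; split=> //.
  exact/stair_event_iff.
move=> [k _ /= [Ht wk]]; apply/stair_event_iff => //.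
by rewrite wk.
Qed.

(** Carrying an arbitrary cylinder on later sites keeps track of the
    independence between the event and the weights not yet revealed. *)
Definition stair_factorizes (M j : nat) : Prop :=
  forall (H : nat -> int) s A, in_W N H -> uniq s -> all (later M j) s ->
  measurable (stair_event M j H) /\
  prob (stair_event M j H `&` cylinder w s A) = D M j H * prob (cylinder w s A).

Lemma stair_factorizes_init : stair_factorizes 0 0.
Proof.
move=> H s A HW us ls.
have -> : stair_event 0 0 H = if [forall j : 'I_N, x j.+1 < H j.+1] then setT else set0.
  case: ifP => [/forallP xH|/forallP xH].
    rewrite -subTset => t _ [|i] iN //; exact: (xH (Ordinal iN)).
  rewrite -subset0 => t Ht; apply: xH => j; exact: (Ht j.+1 (ltn_ord j)).
have -> : D 0 0 H = [forall j : 'I_N, x j.+1 < H j.+1]%:R.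
  exact: det_entry0.
case: ifP => _; first by rewrite setTI mul1r.
by rewrite set0I measure0 mul0r.
Qed.

Lemma stair_factorizes_row M : stair_factorizes M N -> stair_factorizes M.+1 0.
Proof.
move=> MN H s A HW us ls.
have -> : stair_event M.+1 0 H = stair_event M N H.
  apply/seteqP; split=> t Ht i iN; have := Ht i iN;
    by have [i0 iN'] := andP iN; rewrite (stair_gt M.+1 0) // stair_le.
rewrite -stair_det_full; apply: MN => //; apply: sub_all ls => ij.
rewrite /later; lia.
Qed.

(** Prescribing the weight at the site (M+1, j+1) turns a cylinder on later sites
    into a cylinder on sites later than the previous one, to which the induction
    hypothesis applies. *)
Lemma stair_factorizes_site M j : (j < N)%N ->
  stair_factorizes M j -> stair_factorizes M j.+1.
Proof.
move=> jN Mj H s A HW us ls.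
(* Below the threshold x_1 - j all the entries of column j+1 vanish. *)
pose K := `|(H j.+1 - (x 1%N - j%:Z))%R|%N.
have HK : H j.+1 - K%:Z <= x 1%N - j%:Z by lia.
have x1 := @in_W_le N x 1%N j.+1 xW isT isT jN.
have ls' : all (later M j) ((M.+1, j.+1) :: s).
  apply/andP; split; first by rewrite /later /=; lia.
  by apply: sub_all ls => ij; rewrite /later; lia.
have us' : uniq ((M.+1, j.+1) :: s).
  rewrite /= us andbT; apply/negP => /(allP ls); rewrite /later /=; lia.
have /andP[ijs _] := us'.
pose A' k (kl : nat * nat) := if kl == (M.+1, j.+1) then [set k] else A kl.
pose Hk k := lower j.+1 (H j.+1 - k%:Z) H.
have piece (k : nat) := Mj (Hk k) _ (A' k) (lower_in_W _ _ _ _ HW) us' ls'.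
have HE := stair_eventE M j H K jN HW ltac:(lia).
have mpiece (k : 'I_K) : measurable (stair_event M j (Hk k)
    `&` w M.+1 j.+1 @^-1` [set nat_of_ord k]).
  by apply: measurableI; [exact: (piece k).1|exact: measurable_weight].
split; first by rewrite HE; apply: bigsetU_measurable => k _; exact: mpiece.
pose F k := stair_event M j (Hk k) `&` cylinder w ((M.+1, j.+1) :: s) (A' k).
have FE k : F k = stair_event M j (Hk k) `&`
    (w M.+1 j.+1 @^-1` [set k] `&` cylinder w s A).
  by rewrite /F /A' cylinder_cons.
have mF k : measurable (F k).
  by apply: measurableI; [exact: (piece k).1|exact: measurable_cylinder].
have -> : stair_event M j.+1 H `&` cylinder w s A = \big[setU/set0]_(k < K) F k.
  rewrite HE -!(bigcup_mkord K (fun k =>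
    stair_event M j (Hk k) `&` w M.+1 j.+1 @^-1` [set k])) -(bigcup_mkord K F).
  by rewrite setI_bigcupl; apply: eq_bigcupr => k _; rewrite FE setIA.
rewrite measure_bigsetU_ord //; last first.
  apply/trivIsetP => k l _ _ kl; rewrite !FE -subset0 => t [[_ [wk _]] [_ [wl _]]].
  by apply: (negP kl); apply/eqP/val_inj; rewrite /= -wk -wl.
rewrite (eq_bigr (fun k : 'I_K => (fine (P (F k)))%:E)); last first.
  by move=> k _; rewrite fineK //; exact: fin_num_measure.
rewrite sumEFin /= rmorph_sum /=.
rewrite (@stair_det_sum _ _ _ (fun m j => (a m * b j)%:C%C)
  (next_scale R a b) _ _ M j H K jN HW); first last.
- move=> h i iN hK; apply: (@entry_eq0 R a b x N) => //.
  by have := @in_W_le N x 1%N i xW isT; lia.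
- by move=> *; apply: (@entry_next R a b x N).
- by move=> *; apply: (@entry_step R a b x N).
rewrite mulr_suml; apply: eq_bigr => k _.
rewrite (piece k).2 /A' cylinder_cons //.
rewrite (prob_cylinder_cons (M.+1, j.+1)) //; last first.
  by apply: sub_all ls' => ij; rewrite /later; lia.
rewrite mulrA; congr (_ * _); rewrite mulrC; congr (_ * _).
by rewrite rmorphM rmorphB rmorph1 rmorphXn.
Qed.

Lemma stair_factorization M j : (j <= N)%N -> stair_factorizes M j.
Proof.
have row M' : stair_factorizes M' 0 -> forall j, (j <= N)%N -> stair_factorizes M' j.
  move=> M0; elim=> [//|k IH] kN; apply: stair_factorizes_site => //.
  by apply: IH; exact: ltnW.
move: j; elim: M => [|M IH]; apply: row; first exact: stair_factorizes_init.
by apply: stair_factorizes_row; exact: IH.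
Qed.

End Process.

(** * Thresholds constant on blocks *)

Section Blocks.
Variables (n : nat -> nat) (h hblock : nat -> int) (p : nat).
Hypothesis n_incr : forall k, (k < p)%N -> (n k < n k.+1)%N.

Lemma block_end_le k : (k <= p)%N -> (n k <= n p)%N.
Proof.
move=> kp; rewrite -(subKn kp); elim: (p - k)%N => [|q IH]; first by rewrite subn0.
have [qp|pq] := ltnP q p; last by rewrite (_ : p - q.+1 = p - q)%N //; lia.
apply: leq_trans IH; have := n_incr (p - q.+1) ltac:(lia).
by rewrite (_ : (p - q.+1).+1 = p - q)%N; lia.
Qed.

Hypothesis n0 : n 0%N = 0%N.
Hypothesis h_mono : forall k, (0 < k)%N -> (k < p)%N -> h k <= h k.+1.
Hypothesis hblockE : forall k j, (0 < k <= p)%N -> (n k.-1 < j <= n k)%N ->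
  hblock j = h k.

Lemma in_block j : (0 < j <= n p)%N ->
  exists2 k, (0 < k <= p)%N & (n k.-1 < j <= n k)%N.
Proof.
have E q : (0 < j <= n q)%N -> exists2 k, (0 < k <= q)%N & (n k.-1 < j <= n k)%N.
  elim: q => [|q IH] jq; first by rewrite n0 in jq; lia.
  have [jn|nj] := leqP j (n q); last by exists q.+1; rewrite //= nj; lia.
  by have [|k kq kj] := IH; [lia|exists k => //; lia].
exact: E.
Qed.

Lemma hblock_in_W : in_W (n p) hblock.
Proof.
move=> j j0 jN; have [k kp kj] := in_block j ltac:(lia).
have [jk|nkj] := leqP j.+1 (n k).
  by rewrite (hblockE k j kp kj) (hblockE k j.+1 kp) //; lia.
have jE : j = n k by lia.
have k_lt_p : (k < p)%N.
  by rewrite ltn_neqAle; apply/andP; split; [apply/eqP => kE; rewrite kE in jE|]; lia.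
rewrite (hblockE k j kp kj) (hblockE k.+1 j.+1); [|lia|]; last first.
  by have := n_incr k k_lt_p; rewrite /=; lia.
by apply: h_mono; lia.
Qed.

Lemma block_event_iff (G : nat -> int) : in_W (n p) G ->
  (forall k, (0 < k <= p)%N -> G (n k) < h k) <->
  (forall j, (0 < j <= n p)%N -> G j < hblock j).
Proof.
move=> GW; split=> Gh.
  move=> j jN; have [k kp kj] := in_block j jN.
  rewrite (hblockE k j kp kj); apply: le_lt_trans (Gh k kp).
  apply: (in_W_le _ _ _ _ GW); [lia|lia|].
  by apply: block_end_le; lia.
move=> k kp; have nk := n_incr k.-1 ltac:(lia).
have kE : k.-1.+1 = k by lia.
rewrite kE in nk.
rewrite -(hblockE k (n k) kp); last by rewrite nk leqnn.
by apply: Gh; have := block_end_le k; lia.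
Qed.

End Blocks.

Theorem theorem2 (R : realType) (d : measure_display) (T : measurableType d)
    (P : probability T R) (a b : nat -> R) (w : nat -> nat -> {RV P >-> nat})
    (a01 : forall i : nat, (0 < i)%N -> 0 <= a i <= 1)
    (b01 : forall j : nat, (0 < j)%N -> 0 <= b j <= 1)
    (ab01 : forall i j : nat, (0 < i)%N -> (0 < j)%N -> 0 < a i * b j < 1)
    (hw : geometric_weights a b w)
    (N p : nat) (n : nat -> nat) (hp : (0 < p)%N)
    (n0 : n 0%N = 0%N) (n_incr : forall k : nat, (k < p)%N -> (n k < n k.+1)%N)
    (np : n p = N)
    (x : nat -> int) (hx : in_W N x)
    (g0 : int) (hg0 : g0 <= x 1%N)
    (h : nat -> int)
    (h_mono : forall k : nat, (0 < k)%N -> (k < p)%N -> h k <= h k.+1)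
    (hblock : nat -> int)
    (hblockE : forall k j : nat, (0 < k <= p)%N -> (n k.-1 < j <= n k)%N ->
       hblock j = h k)
    (m : nat) (r : R) (hr : forall j : nat, (0 < j <= N)%N -> (b j)^-1 < r) :
  (fine (P [set t | forall k : nat, (0 < k <= p)%N ->
      growth g0 x (fun i j => w i j t) m (n k) < h k]))%:C%C =
  \det (\matrix_(i < N, j < N) F_entry a b x hblock m r i.+1 j.+1).
Proof.
have b_gt0 j : (0 < j)%N -> 0 < b j.
  move=> j0; have /andP[bj0 _] := b01 j j0; rewrite lt_neqAle bj0 andbT.
  apply/eqP => bj; have := ab01 1%N j isT j0.
  by rewrite -bj mulr0 ltxx.
have a_ge0 i : (0 < i)%N -> 0 <= a i by move=> i0; have /andP[] := a01 i i0.
have ab_lt1 i j : (0 < i)%N -> (0 < j)%N -> a i * b j < 1.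
  by move=> i0 j0; have /andP[] := ab01 i j i0 j0.
have N_gt0 : (0 < N)%N.
  by have := n_incr 0%N hp; have := block_end_le n p n_incr 1%N hp; lia.
have hblockW : in_W N hblock.
  by rewrite -np; exact: (hblock_in_W n h hblock p).
have fact := @stair_factorization R d T P a b w a_ge0 b_gt0 ab_lt1 hw N x g0 r
  N_gt0 hx hg0 hr m 0 isT hblock [::] (fun=> set0) hblockW isT isT.
have cylT : cylinder w [::] (fun=> set0) = setT.
  by rewrite -subTset => t _ ij.
have [_] := fact; rewrite cylT setIT probability_setT mulr1 => prob_event.
rewrite (_ : [set t | _] = stair_event R d T P w N x g0 m 0 hblock).
  by rewrite prob_event.
apply/seteqP; split=> t.
  move=> Gh i iN; rewrite stair_gt; last by have /andP[] := iN.
  move: i iN; rewrite -np; apply/(block_event_iff n h hblock p) => //.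
  by rewrite np; exact: growth_in_W.
move=> Gh; apply/(block_event_iff n h hblock p) => //.
  by rewrite np; exact: growth_in_W.
move=> j jN; rewrite np in jN; have := Gh j jN; rewrite stair_gt //.
by have /andP[] := jN.
Qed.
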